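(* Let $n\geq 5$ be an integer, let $W_n$ be the wheel graph on $n$ vertices, and let $W_n-e$ be the subgraph obtained from $W_n$ by deleting an edge $e$ which lies on the cycle. Let $B_n=\begin{bmatrix}0&\mathbf{e}'\\ \mathbf{e}&T_{n-1}\end{bmatrix}$ be the $n\times n$ matrix in which $\mathbf{e}\in\mathbb{R}^{n-1}$ is the all-ones column vector and $T_{n-1}$ is the $(n-1)\times(n-1)$ tridiagonal matrix all of whose diagonal, superdiagonal and subdiagonal entries equal $-2$. Then $$\det(E(W_n-e))=\det(B_n)=\begin{cases}0 & \text{if } n\equiv 0\pmod 3,\\ 2^{n-2}\left(\frac{n-1}{3}\right) & \text{if } n\equiv 1\pmod 3,\\ -2^{n-2}\left(\frac{n+1}{3}\right) & \text{if } n\equiv 2\pmod 3,\end{cases}$$ where $E(W_n-e)$ is the eccentricity matrix of $W_n-e$.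
   Context: The prime denotes transpose. For a simple connected graph $G$ with vertices $v_1,\dots,v_n$, let $d(v_i,v_j)$ be the length of a shortest path between $v_i$ and $v_j$, and let $e(v_i)=\max\{d(v_i,v_j):1\le j\le n\}$ be the eccentricity of $v_i$. The eccentricity matrix $E(G)$ is the $n\times n$ real matrix with $(E(G))_{ij}=d(v_i,v_j)$ if $d(v_i,v_j)=\min\{e(v_i),e(v_j)\}$, and $(E(G))_{ij}=0$ otherwise (distances and eccentricities computed in $G$). The wheel graph $W_n$ is the graph on $n$ vertices consisting of a cycle of length $n-1$ together with one further vertex (the hub) adjacent to every vertex of the cycle. The vertices are labelled so that $v_1$ is the hub and $v_2,\dots,v_n$ are the cycle vertices in cyclic order. *)

(* Defs.v *)
From HB Require Import structures.
From mathcomp Require Import all_boot all_order all_algebra.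

Set Implicit Arguments.
Unset Strict Implicit.
Unset Printing Implicit Defensive.

Import GRing.Theory.

Local Open Scope ring_scope.

Record sgraph (T : finType) := SGraph {
  adj :> rel T;
  adj_sym : symmetric adj;
  adj_irrefl : irreflexive adj
}.

Section Graphs.
Variable T : finType.
Implicit Types (G : sgraph T) (x y : T) (e : {set T}).

Definition edges G : {set {set T}} :=
  [set [set p.1; p.2] | p : T * T & G p.1 p.2].

Definition has_path G x y (k : nat) : bool :=
  [exists p : k.-tuple T,
    [&& path G x p, uniq (x :: p) & last x p == y]].

(* Paths have length less than #|T|, so this is the length of a shortest path
   when x and y are connected; it is #|T| otherwise. *)
Definition dist G x y : nat := find (has_path G x y) (iota 0 #|T|).

Definition ecc G x : nat := (\max_(y : T) dist G x y)%N.

Definition del_edge_rel G e : rel T :=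
  fun x y => G x y && ([set x; y] != e).

Fact del_edge_sym G e : symmetric (del_edge_rel G e).
Proof. by move=> x y; rewrite /del_edge_rel adj_sym setUC. Qed.

Fact del_edge_irrefl G e : irreflexive (del_edge_rel G e).
Proof. by move=> x; rewrite /del_edge_rel adj_irrefl. Qed.

Definition del_edge G e : sgraph T :=
  SGraph (del_edge_sym G e) (del_edge_irrefl G e).

End Graphs.

Definition ecc_mx (R : pzSemiRingType) n (G : sgraph 'I_n) : 'M[R]_n :=
  \matrix_(i, j)
    if dist G i j == minn (ecc G i) (ecc G j) then (dist G i j)%:R else 0.

(* The hub is the vertex 0; the cycle vertices are 1, ..., n.-1, and the
   successor of n.-1 on the cycle is 1. *)
Definition rim_next n : rel 'I_n :=
  fun i j => [&& (0 < i)%N, (0 < j)%N &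
    (j == i.+1 :> nat) || (i.+1 == n) && (j == 1%N :> nat)].

(* The test i != j only matters when n = 2. *)
Definition rim_rel n : rel 'I_n :=
  fun i j => (i != j) && (rim_next i j || rim_next j i).

Fact rim_sym n : symmetric (@rim_rel n).
Proof. by move=> i j; rewrite /rim_rel eq_sym orbC. Qed.

Fact rim_irrefl n : irreflexive (@rim_rel n).
Proof. by move=> i; rewrite /rim_rel eqxx. Qed.

Definition rim n : sgraph 'I_n := SGraph (@rim_sym n) (@rim_irrefl n).

Definition wheel_rel n : rel 'I_n :=
  fun i j => rim n i j || (i != j) && ((i == 0%N :> nat) || (j == 0%N :> nat)).

Fact wheel_sym n : symmetric (@wheel_rel n).
Proof.
by move=> i j; rewrite /wheel_rel adj_sym eq_sym (orbC (i == 0%N :> nat)).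
Qed.

Fact wheel_irrefl n : irreflexive (@wheel_rel n).
Proof. by move=> i; rewrite /wheel_rel adj_irrefl eqxx. Qed.

Definition wheel n : sgraph 'I_n := SGraph (@wheel_sym n) (@wheel_irrefl n).

Definition T_mx (R : pzRingType) m : 'M[R]_m :=
  \matrix_(i < m, j < m)
    if [|| i == j, i.+1 == j :> nat | j.+1 == i :> nat] then - 2 else 0.

Definition B_mx (R : pzRingType) n : 'M[R]_(1 + n.-1) :=
  block_mx (0 : 'M_1) (const_mx 1 : 'rV_n.-1)
           (const_mx 1 : 'cV_n.-1) (T_mx R n.-1).

(* Main.v *)
(** Write [n = m + 1]. Every vertex is within distance 1 of the hub, so the
    eccentricity matrix has entries [1] between hub and rim and entries [2]
    exactly at the non-adjacent pairs of rim vertices. Rotating the rim turns the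
    cut cycle into the path [1 - 2 - ... - m]; subtracting twice the hub row from
    all rim rows then gives [B_mx].

    If [y T = (1, ..., 1)], subtracting [y] times the lower rows of [B_mx] from
    the first one makes it block triangular, so [det B = - (sum of y) * det T].
    Such a [y] always exists: take [-1/2] at the positions congruent to [r] mod 3
    for a suitable [r], so that every window of three consecutive positions (and
    each truncated window at the ends) contains exactly one of them. Finally
    [det T_(m+3) = 8 * det T_m] by the three-term recurrence. *)
Require Import Defs.
From HB Require Import structures.
From mathcomp Require Import all_boot all_order all_algebra.
From mathcomp Require Import fingroup perm zify ring.

Set Implicit Arguments.
Unset Strict Implicit.
Unset Printing Implicit Defensive.

Import Order.TTheory GRing.Theory Num.Theory.
Local Open Scope ring_scope.

Lemma eq_set2 (T : finType) (x y a b : T) :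
  ([set x; y] == [set a; b])
  = (x == a) && (y == b) || (x == b) && (y == a).
Proof.
apply/eqP/idP => [/setP H|]; last first.
  by case/orP=> /andP[/eqP-> /eqP->] //; rewrite setUC.
move: (H x) (H y) (H a) (H b); rewrite !in_set2 !eqxx !orbT /=.
rewrite (eq_sym a x) (eq_sym a y) (eq_sym b x) (eq_sym b y).
by case: (x == a); case: (x == b); case: (y == a); case: (y == b).
Qed.

(** * Distances and eccentricities in a graph with a dominating vertex *)

Section HubDistance.
Variables (T : finType) (G : sgraph T) (h : T).
Hypothesis hubP : forall x, x != h -> G h x.
Hypothesis cardT : (2 < #|T|)%N.

Lemma has_path0 x y : has_path G x y 0 = (x == y).
Proof.
apply/existsP/idP => [[p]|xy]; first by rewrite tuple0.
by exists [tuple]; rewrite /= xy.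
Qed.

Lemma has_path1 x y : has_path G x y 1 = G x y.
Proof.
apply/existsP/idP => [[p]|xy].
  by case/tupleP: p => z p; rewrite tuple0 /= => /and3P[/andP[+ _] _ /eqP <-].
exists [tuple y]; rewrite /= xy eqxx inE !andbT /=.
by apply/eqP=> E; rewrite E adj_irrefl in xy.
Qed.

(** Distinct non-adjacent vertices are joined through [h]. Having at least three vertices makes the
    search in [dist] reach length 2. *)
Lemma dist_hub x y :
  dist G x y = if x == y then 0%N else if G x y then 1%N else 2%N.
Proof.
rewrite /dist; case: #|T| cardT => [|[|[|k]]] // _ /=.
rewrite has_path0 has_path1; case: eqVneq => // xy; case: ifP => // Gxy.
suff -> : has_path G x y 2 by [].
have xh : x != h.
  by apply/eqP=> E; rewrite E hubP // -E eq_sym in Gxy.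
have yh : y != h by apply/eqP=> E; rewrite adj_sym E hubP in Gxy.
apply/existsP; exists [tuple h; y].
by rewrite /= !inE !negb_or xh xy (eq_sym h) yh adj_sym !hubP //= eqxx.
Qed.

Lemma ecc_hub : ecc G h = 1%N.
Proof.
apply/eqP; rewrite eqn_leq; apply/andP; split.
  apply/bigmax_leqP => y _; rewrite dist_hub; case: eqVneq => // hy.
  by rewrite hubP // eq_sym.
have [y yh] : exists y, y != h.
  apply/existsP; rewrite -negb_forall; apply/negP => /forallP H.
  have := cardT; rewrite (eq_card1 (x := h)) // => y.
  by rewrite [RHS]inE H.
apply: leq_trans (leq_bigmax y).
by rewrite dist_hub eq_sym (negPf yh) hubP.
Qed.

Lemma ecc_nonadjacent x y : x != y -> ~~ G x y -> ecc G x = 2%N.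
Proof.
move=> xy Gxy; apply/eqP; rewrite eqn_leq; apply/andP; split.
  by apply/bigmax_leqP => z _; rewrite dist_hub; do 2?case: ifP.
apply: leq_trans (leq_bigmax y).
by rewrite dist_hub (negPf xy) (negPf Gxy).
Qed.

End HubDistance.

(** * Rotating the rim so that the deleted edge closes the cycle *)

Section Rotation.
Variables (m : nat) (a : 'I_m.+1).

(** The hub [0] stays fixed; positions [1] to [m] shift cyclically by [a] among themselves, so a
    wrap subtracts [m]. *)
Definition rot_nat (k : nat) : nat :=
  if k == 0%N then 0%N else if (k + a <= m)%N then (k + a)%N else (k + a - m)%N.

Lemma rot_natE (k : nat) :
  [\/ k = 0 /\ rot_nat k = 0,
      [/\ 0 < k, k + a <= m & rot_nat k = k + a]
    | [/\ 0 < k, m < k + a & rot_nat k = k + a - m]]%N.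
Proof.
rewrite /rot_nat; case: (posnP k) => [->|k0]; first by constructor 1.
by case: leqP => ka; [constructor 2 | constructor 3].
Qed.

Lemma rot_nat_lt (k : 'I_m.+1) : (rot_nat k < m.+1)%N.
Proof.
by have := ltn_ord k; have := ltn_ord a; case: (rot_natE k) => -[]; lia.
Qed.

Definition rot_ord (k : 'I_m.+1) : 'I_m.+1 := Ordinal (rot_nat_lt k).

Hypothesis a_gt0 : (0 < a)%N.

Lemma rot_ord_inj : injective rot_ord.
Proof.
move=> k l /(congr1 val) /= E; apply: val_inj => /=.
have := ltn_ord k; have := ltn_ord l; have := ltn_ord a.
by move: a_gt0 E; case: (rot_natE k) => -[]; case: (rot_natE l) => -[]; lia.
Qed.

(* The vertex after [a] on the rim is [rot_ord] of position 1, and [a] itself is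
   [rot_ord] of position [m]: the deleted edge closes up the path. *)
Lemma del_edge_wheel_rot (b : 'I_m.+1) (k l : 'I_m.+1) :
  (4 <= m)%N -> rim_next a b ->
  del_edge (wheel m.+1) [set a; b] (rot_ord k) (rot_ord l)
  = (k != l) && [|| k == 0%N :> nat, l == 0%N :> nat, k.+1 == l :> nat
                  | l.+1 == k :> nat].
Proof.
move=> m4 /and3P[_ b0 ab].
rewrite /= /del_edge_rel /= /wheel_rel /= /rim_rel /rim_next eq_set2.
rewrite -!(inj_eq val_inj) /=.
have := ltn_ord k; have := ltn_ord l; have := ltn_ord a; have := ltn_ord b.
have {}ab : (b = a.+1 :> nat \/ (a = m :> nat /\ b = 1 :> nat))%N by lia.
case: (rot_natE k) => -[]; case: (rot_natE l) => -[];
  move: (rot_nat k) (rot_nat l) => u v; move: a_gt0 ab b0;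
  move: (nat_of_ord a) (nat_of_ord b) (nat_of_ord k) (nat_of_ord l);
  move=> ? ? ? ? ? [->|[-> ->]].
all: lia.
Qed.

End Rotation.

(** * From the eccentricity matrix to [B_mx] *)

Section EccMatrix.
Variables (R : comNzRingType) (m : nat) (a b : 'I_m.+1).
Hypotheses (m4 : (4 <= m)%N) (ab : rim_next a b).
Let G := del_edge (wheel m.+1) [set a; b].

Let a_gt0 : (0 < a)%N. Proof. by case/and3P: ab. Qed.
Let rotI := rot_ord_inj a_gt0.
Let s : {perm 'I_m.+1} := perm rotI.

Let GE k l : G (s k) (s l) =
  (k != l) && [|| k == 0%N :> nat, l == 0%N :> nat, k.+1 == l :> nat
                | l.+1 == k :> nat].
Proof. by rewrite !permE (del_edge_wheel_rot a_gt0 k l m4 ab). Qed.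

Let hubP x : x != s ord0 -> G (s ord0) x.
Proof.
rewrite -[x](permKV s); set y := (s^-1)%g x.
by rewrite (inj_eq perm_inj) GE eq_sym => ->.
Qed.

Let card_gt2 : (2 < #|'I_m.+1|)%N.
Proof. by rewrite card_ord; lia. Qed.

Let ecc_rot k : ecc G (s k) = if k == ord0 then 1%N else 2%N.
Proof.
case: eqVneq => [->|k0]; first exact: ecc_hub hubP card_gt2.
move: k0; rewrite -(inj_eq val_inj) /= => k0.
(* A rim position not adjacent to [k] on the path; [4] exists because [4 <= m]. *)
pose l : 'I_m.+1 := inord (if (k <= 2)%N then 4%N else 1%N).
have lE : l = (if (k <= 2)%N then 4%N else 1%N) :> nat.
  by rewrite inordK //; case: ifP => _; lia.
apply: (ecc_nonadjacent hubP card_gt2 (y := s l)).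
  by rewrite (inj_eq perm_inj) -(inj_eq val_inj) /= lE; case: ifP; lia.
by rewrite GE -(inj_eq val_inj) /= lE; case: ifP; lia.
Qed.

(** The left factor adds twice the hub row to each rim row: the entries [-2] of [T_mx], at equal or
    adjacent positions, become 0 and the others become 2. *)
Lemma ecc_mx_perm :
  row_perm s (col_perm s (ecc_mx R G))
  = block_mx (1%:M : 'M_1) 0 (const_mx 2) 1%:M *m B_mx R m.+1.
Proof.
rewrite /B_mx mulmx_block !mul1mx !mul0mx !addr0 mulmx0 add0r.
apply/matrixP=> k l; do 3!rewrite [LHS]mxE.
rewrite (dist_hub hubP) // !ecc_rot (inj_eq perm_inj) GE -!(inj_eq val_inj).
case: (@split_ordP 1 m k) => i ->; case: (@split_ordP 1 m l) => j ->;
  [ rewrite [RHS](@block_mxEul _ 1 m 1 m) | rewrite [RHS](@block_mxEur _ 1 m 1 m)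
  | rewrite [RHS](@block_mxEdl _ 1 m 1 m) | rewrite [RHS](@block_mxEdr _ 1 m 1 m)];
  rewrite ?ord1 !mxE /= ?eqxx //.
rewrite big_ord1 !mxE mulr1 !add1n !eqSS -(inj_eq val_inj) /=.
case: (eqVneq (i : nat) j) => _ /=; first by rewrite subrr.
by case: (_ || _); rewrite /= ?subrr ?addr0.
Qed.

Lemma det_ecc_mx_del_edge : \det (ecc_mx R G) = \det (B_mx R m.+1).
Proof.
have := congr1 determinant ecc_mx_perm.
rewrite det_mulmx (@det_lblock _ 1 m) !det1 !mul1r => <-.
(* Rows and columns undergo the same permutation, so its sign occurs twice and cancels. *)
rewrite row_permE col_permE !det_mulmx !det_perm odd_permV mulrCA.
by rewrite -signr_addb addbb mulr1.
Qed.

End EccMatrix.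

(** * Determinant of the tridiagonal matrix *)

Section Tridiagonal.
Variable R : comNzRingType.

Lemma det_T_mxSS m :
  \det (T_mx R m.+2) = - 2 * \det (T_mx R m.+1) - 4 * \det (T_mx R m).
Proof.
rewrite (expand_det_row _ ord0) 2!big_ord_recl big1 ?addr0; last first.
  by move=> i _; rewrite mxE /= mul0r.
rewrite /cofactor !mxE /= expr0 expr1 !mul1r.
congr (_ * \det _ + _).
  by apply/matrixP=> i j; rewrite !mxE /= -!(inj_eq val_inj) /= /bump !add1n !eqSS.
(* In the minor without row 0 and column 1, the first column has only its top entry nonzero. *)
rewrite (expand_det_col _ ord0) big_ord_recl big1 ?addr0; last first.
  by move=> i _; rewrite !mxE /= mul0r.
rewrite /cofactor !mxE /= expr0 !mul1r mulrA.
set A := row' _ _; have -> : A = T_mx R m.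
  by apply/matrixP=> i j; rewrite !mxE /= -!(inj_eq val_inj) /= /bump !add1n !eqSS.
by ring.
Qed.

Lemma det_T_mx3 m : \det (T_mx R m.+3) = 8 * \det (T_mx R m).
Proof. by rewrite !det_T_mxSS; ring. Qed.

Lemma det_T_mx_mod0 k : \det (T_mx R (k * 3)) = 2 ^+ (k * 3).
Proof.
elim: k => [|k IH]; first by rewrite det_mx00.
by rewrite mulSn det_T_mx3 IH !exprS; ring.
Qed.

Lemma det_T_mx_mod1 k : \det (T_mx R (k * 3).+1) = - 2 ^+ (k * 3).+1.
Proof.
elim: k => [|k IH]; first by rewrite det_mx11 mxE.
by rewrite mulSn det_T_mx3 IH !exprS; ring.
Qed.

Lemma det_T_mx_mod2 k : \det (T_mx R (k * 3).+2) = 0.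
Proof. by rewrite det_T_mxSS det_T_mx_mod0 det_T_mx_mod1 !exprS; ring. Qed.

End Tridiagonal.

(** * Determinant of [B_mx] from a solution of [y T = (1, ..., 1)] *)

Lemma det_B_mx_solution (R : comNzRingType) m (y : 'rV[R]_m) :
  y *m T_mx R m = const_mx 1 ->
  \det (B_mx R m.+1) = - (\sum_i y 0 i) * \det (T_mx R m).
Proof.
move=> yT.
have := congr1 determinant
  (mulmx_block (1%:M : 'M_1) (- y) 0 1%:M 0 (const_mx 1) (const_mx 1) (T_mx R m)).
rewrite !(mul1mx, mul0mx, add0r, mulNmx) yT subrr det_mulmx det_ublock !det1 !mul1r.
move=> ->; rewrite det_lblock det_mx11 !mxE; congr (- _ * _).
by apply: eq_bigr => i _; rewrite mxE mulr1.
Qed.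

Section Solution.
Variable R : numFieldType.

Definition T_sol (r m : nat) : 'rV[R]_m :=
  \row_(i < m) if (i %% 3 == r)%N then - 2^-1 else 0.

(** Indices start at 0. The last window [{m-2, m-1}] misses residue 0 exactly when 3 divides [m];
    residue 1 then meets both truncated windows. *)
Lemma T_solP (r m : nat) :
  (r = 0 /\ m %% 3 <> 0 \/ r = 1 /\ m %% 3 = 0)%N ->
  T_sol r m *m T_mx R m = const_mx 1.
Proof.
move=> rm; apply/matrixP=> i j; rewrite !mxE.
(* The one index of the window around [j] with residue [r]. As [r <= 1], the branch [j.-1] is never
   taken at [j = 0]. *)
pose u := (if (j %% 3 == r)%N then j : nat
           else if (j.+1 %% 3 == r)%N then j.+1 else j.-1)%N.
have [um ur uj] : [/\ (u < m)%N, (u %% 3 = r)%N & (u <= j.+1 <= u.+2)%N].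
  by have := ltn_ord j; rewrite /u; do 2?case: eqP => ?; split; lia.
rewrite (bigD1 (Ordinal um)) //= big1 ?addr0.
  rewrite !mxE /= ur eqxx -!(inj_eq val_inj) /= ifT; last by lia.
  by rewrite mulrNN mulVf // pnatr_eq0.
move=> k; rewrite -(inj_eq val_inj) !mxE /= -(inj_eq val_inj) /= => ku.
case: ifP => kr; last by rewrite mul0r.
by rewrite ifF ?mulr0 //; lia.
Qed.

(** The quotient counts the indices below [m] congruent to [r] mod 3. *)
Lemma sum_T_sol (r m : nat) : (r < 3)%N ->
  \sum_i T_sol r m 0 i = - ((m + 2 - r) %/ 3)%:R / 2.
Proof.
move=> r3; rewrite mulNr mulrC -mulNr.
transitivity (- 2^-1 * (\sum_(i < m) (i %% 3 == r)%N)%:R : R).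
  rewrite natr_sum mulr_sumr; apply: eq_bigr => i _; rewrite mxE.
  by case: ifP; rewrite ?mulr1 ?mulr0.
congr (_ * _%:R); elim: m => [|m IH]; first by rewrite big_ord0; lia.
by rewrite big_ord_recr /= IH; lia.
Qed.

(** The suffix is the residue of [n - 1], not of [n]. The factor 2 on the left avoids the exponent
    [k * 3 - 1]. *)
Lemma det_B_mx_mod0 k : \det (B_mx R (k * 3).+1) * 2 = 2 ^+ (k * 3) * k%:R.
Proof.
rewrite (det_B_mx_solution (T_solP (r := 1) _)); last by right; lia.
rewrite sum_T_sol // det_T_mx_mod0.
have -> : ((k * 3 + 2 - 1) %/ 3 = k)%N by lia.
by field.
Qed.

Lemma det_B_mx_mod1 k : \det (B_mx R (k * 3).+2) = - 2 ^+ (k * 3) * k.+1%:R.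
Proof.
rewrite (det_B_mx_solution (T_solP (r := 0) _)); last by left; lia.
rewrite sum_T_sol // det_T_mx_mod1.
have -> : (((k * 3).+1 + 2 - 0) %/ 3 = k.+1)%N by lia.
by rewrite exprS; field.
Qed.

Lemma det_B_mx_mod2 k : \det (B_mx R (k * 3).+3) = 0.
Proof.
(* Only the existence of a solution matters here, since [T_mx] is singular. *)
rewrite (det_B_mx_solution (T_solP (r := 0) _)); last by left; lia.
by rewrite det_T_mx_mod2 mulr0.
Qed.

End Solution.

Theorem mainTheorem11 (R : realFieldType) (n : nat) (hn : (5 <= n)%N)
    (e : {set 'I_n}) (he : e \in edges (rim n)) :
  [/\ \det (ecc_mx R (del_edge (wheel n) e)) = \det (B_mx R n),
      (n = 0 %[mod 3])%N -> \det (B_mx R n) = 0,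
      (n = 1 %[mod 3])%N ->
        \det (B_mx R n) = 2 ^+ (n - 2) * ((n%:R - 1) / 3)
    & (n = 2 %[mod 3])%N ->
        \det (B_mx R n) = - 2 ^+ (n - 2) * ((n%:R + 1) / 3)].
Proof.
split.
- case: n hn e he => // m m4 e /imsetP[[a b]]; rewrite inE /= => /andP[_ ab] ->.
  (* The edge may be given against the cyclic order; swapping the unordered pair orients it. *)
  case/orP: ab => ab; last rewrite setUC; exact: det_ecc_mx_del_edge.
- move=> n3; have [k nE] : exists k, n = (k * 3).+3 by exists (n %/ 3).-1; lia.
  by rewrite nE det_B_mx_mod2.
- move=> n3; have [k nE] : exists k, n = (k.+1 * 3).+1.
    by exists (n %/ 3).-1; lia.
  have n2 : (n - 2 = (k * 3).+2)%N by lia.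
  have two0 : (2 : R) != 0 by rewrite pnatr_eq0.
  apply: (mulIf two0); rewrite n2 nE det_B_mx_mod0.
  by rewrite -[(k.+1 * 3).+1%:R]natr1 natrM mulSn !exprS; field.
- move=> n3; have [k nE] : exists k, n = (k * 3).+2 by exists (n %/ 3)%N; lia.
  have n2 : (n - 2 = k * 3)%N by lia.
  rewrite n2 nE det_B_mx_mod1 -[(k * 3).+2%:R]natr1 -[(k * 3).+1%:R]natr1.
  by rewrite -[k.+1%:R]natr1 natrM; field.
Qed.
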